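(* Let $n\ge 1$ and let $k\ge 1$ be odd. Then $ASM^{-}_{n,k}$ is in bijection with the set of $\frac{k+1}{2}$-tuples of $n\times n$ alternating sign matrices.
   Context: An alternating sign matrix is a square matrix with entries in $\{0,1,-1\}$ such that each row and each column sums to $1$ and the nonzero entries alternate in sign along each row and each column. For $n,k\ge1$, $ASM^{-}_{n,k}$ (chained linear alternating sign matrices) is the set of $k$-tuples $(A^{(1)},\dots,A^{(k)})$ of $n\times n$ matrices with entries in $\{-1,0,1\}$ satisfying: (1) $\sum_{j=1}^m A^{(\ell)}_{i,j}\in\{0,1\}$ for all $1\le i\le n$, $1\le m\le n$, $1\le\ell\le k$; (2) $\sum_{j=1}^n A^{(\ell-1)}_{i,j}+\sum_{j=1}^m A^{(\ell)}_{n+1-j,i}\in\{0,1\}$ for all $1\le i\le n$, $1\le m\le n$, $1\le\ell\le k$, where $A^{(0)}$ is the zero matrix; (3) the sum of all entries $\sum_{i,j,\ell}A^{(\ell)}_{i,j}$ is maximum among all such $k$-tuples satisfying (1) and (2). *)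

(* Defs.v *)
From mathcomp Require Import all_boot all_order all_algebra.
From mathcomp Require Import classical_sets functions.

Set Implicit Arguments.
Unset Strict Implicit.
Unset Printing Implicit Defensive.
Import Order.TTheory GRing.Theory Num.Theory.
Local Open Scope ring_scope.
Local Open Scope classical_set_scope.

Definition sign_matrix (n : nat) (M : 'M[int]_n) : Prop :=
  forall i j, M i j \in [:: -1; 0; 1].

Definition alternating (s : seq int) : bool :=
  sorted (fun x y => x * y < 0) [seq x <- s | x != 0].

Definition asm (n : nat) : set 'M[int]_n :=
  [set M | [/\ sign_matrix M,
               (forall i, \sum_(j < n) M i j = 1),
               (forall j, \sum_(i < n) M i j = 1),
               (forall i, alternating [seq M i j | j : 'I_n])
             & (forall j, alternating [seq M i j | i : 'I_n])]].
Arguments asm n : clear implicits.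

Definition asm_tuples (n p : nat) : set (p.-tuple 'M[int]_n) :=
  [set B | forall l : 'I_p, asm n (tnth B l)].
Arguments asm_tuples n p : clear implicits.

Section Chained.
Variables n k : nat.
Implicit Type A : k.-tuple 'M[int]_n.

(* The matrices of the tuple are numbered 1, ..., k, and number 0 is the zero
   matrix.  Rows and columns are indexed from 0, so j = 1, ..., m becomes
   j < m, and the row n + 1 - j becomes rev_ord j. *)
Definition level A (l : nat) : 'M[int]_n := nth 0 (0 :: val A) l.

Definition row_condition A : Prop :=
  forall (i : 'I_n) (m l : nat), (1 <= m <= n)%N -> (1 <= l <= k)%N ->
    \sum_(j < n | (j < m)%N) level A l i j \in [:: 0; 1].

Definition chain_condition A : Prop :=
  forall (i : 'I_n) (m l : nat), (1 <= m <= n)%N -> (1 <= l <= k)%N ->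
    \sum_(j < n) level A l.-1 i j
      + \sum_(j < n | (j < m)%N) level A l (rev_ord j) i \in [:: 0; 1].

Definition chained_admissible A : Prop :=
  [/\ forall l : 'I_k, sign_matrix (tnth A l),
      row_condition A & chain_condition A].

Definition total_sum A : int :=
  \sum_(l < k) \sum_(i < n) \sum_(j < n) tnth A l i j.

Definition chained_linear_asm : set (k.-tuple 'M[int]_n) :=
  [set A | chained_admissible A /\
           forall A', chained_admissible A' -> total_sum A' <= total_sum A].

End Chained.
Arguments chained_linear_asm n k : clear implicits.

(* Main.v *)
Require Import Defs.
From mathcomp Require Import all_boot all_order all_algebra.
From mathcomp Require Import classical_sets functions.
From mathcomp Require Import zify.

(** Let [s_l] be the sum of the entries of the [l]-th matrix of an admissible
    tuple, with [s_0 = 0].  The row condition for full rows says that every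
    row sum lies in {0, 1}, so [0 <= s_l]; the chain condition for full
    columns, summed over all the columns, says that [s_(l-1) + s_l <= n].
    For [k = 2p + 1], pairing the terms of the total as
    [(s_0 + s_1) + (s_2 + s_3) + ... + (s_2p + s_(2p+1))] bounds it by
    [n (p + 1)], and equality forces [s_1 = n], hence [s_2 = 0], hence
    [s_3 = n], and so on ([tight_pairing]).  The bound is attained by identity
    matrices separated by zero matrices.

    In a maximal tuple, all the row sums at an odd level are thus 1, and those
    at an even level are 0.  At an even level the chain condition then says
    that all partial column sums, read from the bottom, are in {-1, 0}; adding
    them up over the columns gives a sum of vanishing row sums, so that they
    all vanish and the matrix is zero ([zero_of_partial_columns]).  At an odd
    level the previous matrix contributes nothing, and the conditions say that
    the row and column partial sums are in {0, 1} with row and column sums 1: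
    this is another description of alternating sign matrices ([asmP]).
    Therefore a tuple is in ASM^-_{n,k} exactly when its even levels vanish
    and its odd levels are arbitrary alternating sign matrices
    ([chained_linear_asmP]), and the bijection keeps the odd levels. *)

Set Implicit Arguments.
Unset Strict Implicit.
Unset Printing Implicit Defensive.
Import Order.TTheory GRing.Theory Num.Theory.
Local Open Scope ring_scope.

(** * Sign sequences and their partial sums *)

Definition partial_sum n (F : 'I_n -> int) (m : nat) : int :=
  \sum_(j < n | (j < m)%N) F j.

Definition partial_sums01 n (F : 'I_n -> int) : Prop :=
  forall m, partial_sum F m \in [:: 0; 1].

Lemma in01P (x : int) : reflect (0 <= x <= 1) (x \in [:: 0; 1]).
Proof. by rewrite !inE; apply: (iffP idP); lia. Qed.

Lemma partial_sum0 n (F : 'I_n -> int) : partial_sum F 0 = 0.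
Proof. by rewrite /partial_sum big_pred0. Qed.

Lemma partial_sum_all n (F : 'I_n -> int) m :
  (n <= m)%N -> partial_sum F m = \sum_(j < n) F j.
Proof.
by move=> le_nm; apply: eq_bigl => j; rewrite (leq_trans (ltn_ord j)).
Qed.

Lemma partial_sumS n (F : 'I_n -> int) (i : 'I_n) :
  partial_sum F i.+1 = partial_sum F i + F i.
Proof.
rewrite /partial_sum (bigD1 i) //= addrC; congr (_ + _).
by apply: eq_bigl => j; rewrite ltnS -val_eqE /=; lia.
Qed.

Lemma eq_partial_sum n (F G : 'I_n -> int) m :
  F =1 G -> partial_sum F m = partial_sum G m.
Proof. by move=> eqFG; apply: eq_bigr. Qed.

Lemma partial_sum_rev n (F : 'I_n -> int) m :
  partial_sum (fun j => F (rev_ord j)) m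
    = \sum_(j < n) F j - partial_sum F (n - m).
Proof.
rewrite /partial_sum (reindex_inj rev_ord_inj) /=.
rewrite [in RHS](bigID (fun j : 'I_n => (j < n - m)%N)) /= addrC addrK.
apply: eq_big => [j|j _]; last by rewrite rev_ordK.
by have := ltn_ord j; lia.
Qed.

Lemma partial_sums01_rev n (F : 'I_n -> int) :
  \sum_(j < n) F j = 1 -> partial_sums01 F ->
  partial_sums01 (fun j => F (rev_ord j)).
Proof.
move=> F1 F01 m; rewrite partial_sum_rev F1.
by move: (F01 (n - m)%N); rewrite !inE; lia.
Qed.

(** The row and chain conditions constrain only the lengths [1 <= m <= n]; the
    other partial sums are empty or equal to the full sum. *)
Lemma partial_sums01_bounded n (F : 'I_n -> int) :
  (forall m, (1 <= m <= n)%N -> partial_sum F m \in [:: 0; 1]) ->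
  partial_sums01 F.
Proof.
move=> F01 m; case: m => [|m]; first by rewrite partial_sum0.
case: (leqP m.+1 n) => [le_mn|lt_nm]; first exact: F01.
rewrite (partial_sum_all _ (ltnW lt_nm)) -(partial_sum_all F (leqnn n)).
case: n F F01 lt_nm => [|n] F F01 _; first by rewrite partial_sum0.
by apply: F01; rewrite leqnn.
Qed.

Lemma sum_take_codom n (F : 'I_n -> int) m :
  \sum_(x <- take m [seq F j | j : 'I_n]) x = partial_sum F m.
Proof.
transitivity (\sum_(j <- enum 'I_n | (j < m)%N) F j); last first.
  by rewrite big_enum_cond; apply: eq_bigl.
rewrite -map_take big_map -[RHS]big_filter.
congr (\sum_(j <- _) F j); apply: (inj_map val_inj).
rewrite map_take val_enum_ord take_iota.
rewrite -(filter_map val (fun j => (j < m)%N)) val_enum_ord.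
rewrite -(filter_iota_ltn 0 (geq_minr m n)) add0n.
apply: eq_in_filter => j; rewrite mem_iota; lia.
Qed.

(** The boolean [b] is the partial sum reached so far: once it is known to be
    in {0, 1}, the next nonzero term is allowed exactly when its sign is
    opposite to the one that led to this partial sum. *)
Lemma path_alternatingP (b : bool) (s : seq int) :
  all (fun x => x \in [:: -1; 0; 1]) s ->
  path (fun x y => x * y < 0) (if b then 1 else -1) [seq x <- s | x != 0]
  <-> (forall m, b%:R + \sum_(x <- take m s) x \in [:: 0; 1]).
Proof.
elim: s b => [|x s IHs] b /=.
  by move=> _; split=> // _ m; rewrite big_nil; case: b.
case/andP=> x_sgn /IHs {}IHs.
have sumS : (forall m, b%:R + \sum_(y <- take m (x :: s)) y \in [:: 0; 1])
    <-> forall m, (b%:R + x) + \sum_(y <- take m s) y \in [:: 0; 1].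
  split=> [+ m|+ [|m]].
  - by move/(_ m.+1); rewrite /= big_cons addrA.
  - by move=> _; rewrite take0 big_nil; case: b.
  - by move/(_ m); rewrite /= big_cons addrA.
rewrite {}sumS.
move: x_sgn; rewrite !inE => /or3P[] /eqP->; case: b => //=.
- by have /= -> := IHs false.
- by split=> // /(_ 0%N); rewrite take0 big_nil.
- by have /= -> := IHs true.
- by have /= -> := IHs false.
- by split=> // /(_ 0%N); rewrite take0 big_nil.
- by have /= -> := IHs true.
Qed.

(** Alternation alone does not fix the first nonzero sign, but the sum does:
    were it -1, all the partial sums would be in {-1, 0} and the sum could not
    be 1. *)
Lemma alternatingP n (F : 'I_n -> int) :
  (forall j, F j \in [:: -1; 0; 1]) -> \sum_(j < n) F j = 1 ->
  alternating [seq F j | j : 'I_n] <-> partial_sums01 F.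
Proof.
move=> F_sgn F1; set s := [seq F j | j : 'I_n].
have s_sgn : all (fun x => x \in [:: -1; 0; 1]) s.
  by apply/allP => _ /mapP[j _ ->].
have s1 : \sum_(x <- take n s) x = 1 by rewrite sum_take_codom partial_sum_all.
have pathP := path_alternatingP _ s_sgn.
have sumP : partial_sums01 F <->
    forall m, false%:R + \sum_(x <- take m s) x \in [:: 0; 1].
  by split=> F01 m; move: (F01 m); rewrite sum_take_codom add0r.
rewrite sumP -pathP /alternating; split; last exact: path_sorted.
have := pathP true.
have : all (fun x => x \in [:: -1; 1]) [seq x <- s | x != 0].
  apply/allP => x; rewrite mem_filter => /andP[x_neq0 /(allP s_sgn)].
  by rewrite !inE (negPf x_neq0).
case: [seq x <- s | x != 0] => [|x t] //= /andP[+ _].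
rewrite !inE => /orP[] /eqP-> /= pathP1 alt_t //.
by have /(_ n) := (pathP1.1 alt_t); rewrite s1.
Qed.

Lemma asmP n (M : 'M[int]_n) :
  asm n M <->
  [/\ sign_matrix M,
      (forall i, \sum_(j < n) M i j = 1),
      (forall j, \sum_(i < n) M i j = 1),
      (forall i, partial_sums01 (M i))
    & (forall j, partial_sums01 (fun i => M i j))].
Proof.
split=> -[M_sgn row1 col1 row_alt col_alt]; split=> // i.
- by apply/alternatingP; [move=> j | exact: row1 | exact: row_alt].
- by apply/alternatingP; [move=> j | exact: col1 | exact: col_alt].
- by apply/alternatingP; [move=> j | exact: row1 | exact: row_alt].
- by apply/alternatingP; [move=> j | exact: col1 | exact: col_alt].
Qed.

Lemma asm1 n : asm n 1%:M.
Proof.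
have sum1 (i : 'I_n) m :
    partial_sum (fun j => (1%:M : 'M[int]_n) i j) m = (i < m)%N%:R.
  rewrite /partial_sum; have [lt_im|le_mi] := ltnP i m.
    rewrite (bigD1 i) //= mxE eqxx big1 ?addr0 // => j /andP[_ ne_ji].
    by rewrite mxE eq_sym (negPf ne_ji).
  apply: big1 => j lt_jm; rewrite mxE; case: eqP => // eq_ij.
  by rewrite eq_ij leqNgt lt_jm in le_mi.
have sym (j : 'I_n) : (fun i => (1%:M : 'M[int]_n) i j) =1 (1%:M : 'M[int]_n) j.
  by move=> i; rewrite !mxE eq_sym.
apply/asmP; split=> [i j|i|j|i m|j m].
- by rewrite mxE; case: (i == j).
- by rewrite -(partial_sum_all _ (leqnn n)) sum1 ltn_ord.
- rewrite (eq_bigr _ (fun i _ => sym j i)) -(partial_sum_all _ (leqnn n)).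
  by rewrite sum1 ltn_ord.
- by rewrite sum1; case: (i < m)%N.
- by rewrite (eq_partial_sum _ (sym j)) sum1; case: (j < m)%N.
Qed.

(** * Sums attaining their upper bound *)

Lemma sum_le1_tight n (F : 'I_n -> int) :
  (forall i, F i <= 1) -> \sum_(i < n) F i = n%:R -> forall i, F i = 1.
Proof.
move=> F_le1 sumF i; apply/eqP; rewrite eq_sym -subr_eq0; apply/eqP.
have : \sum_(i < n) (1 - F i) = 0.
  by rewrite sumrB sumF sumr_const card_ord subrr.
move/eqP; rewrite psumr_eq0 => [/allP /(_ i)|j _]; last by rewrite subr_ge0.
by rewrite mem_index_enum => /(_ isT) /eqP.
Qed.

Lemma sum_ge0_tight n (F : 'I_n -> int) :
  (forall i, 0 <= F i) -> \sum_(i < n) F i = 0 -> forall i, F i = 0.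
Proof.
move=> F_ge0 /eqP; rewrite psumr_eq0 => // /allP F0 i.
by apply/eqP/F0; rewrite mem_index_enum.
Qed.

Lemma sum_pairs (s : nat -> int) p : s 0%N = 0 ->
  \sum_(l < p.*2.+1) s l.+1 = \sum_(q < p.+1) (s q.*2 + s q.*2.+1).
Proof.
move=> s0; elim: p => [|p IHp]; first by rewrite !big_ord1 s0 add0r.
by rewrite doubleS 2!big_ord_recr IHp [RHS]big_ord_recr /= doubleS addrA.
Qed.

(** When the total reaches the bound given by the pairs [(s_2q, s_(2q+1))],
    each of these pairs reaches its bound [N]; the overlapping pairs
    [(s_(2q+1), s_(2q+2))] then propagate [s_0 = 0] along the sequence. *)
Lemma tight_pairing (s : nat -> int) (N : int) p : s 0%N = 0 ->
  (forall l, (l <= p.*2.+1)%N -> 0 <= s l) ->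
  (forall l, (l < p.*2.+1)%N -> s l + s l.+1 <= N) ->
  \sum_(l < p.*2.+1) s l.+1 <= N * p.+1%:R /\
  (\sum_(l < p.*2.+1) s l.+1 = N * p.+1%:R ->
   forall q, (q <= p)%N -> s q.*2 = 0 /\ s q.*2.+1 = N).
Proof.
move=> s0 s_ge0 s_le; rewrite sum_pairs //.
have gap_ge0 (q : 'I_p.+1) : 0 <= N - (s q.*2 + s q.*2.+1).
  by rewrite subr_ge0 s_le //; have := ltn_ord q; lia.
have sum_gap : \sum_(q < p.+1) (N - (s q.*2 + s q.*2.+1))
    = N * p.+1%:R - \sum_(q < p.+1) (s q.*2 + s q.*2.+1).
  by rewrite sumrB sumr_const card_ord mulr_natr.
split; first by rewrite -subr_ge0 -sum_gap sumr_ge0.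
move=> sumE.
have gap0 : forall q : 'I_p.+1, N - (s q.*2 + s q.*2.+1) = 0.
  by apply: sum_ge0_tight => //; rewrite sum_gap sumE subrr.
have pairE q : (q <= p)%N -> s q.*2 + s q.*2.+1 = N.
  by move=> le_qp; have := gap0 (Ordinal (le_qp : (q < p.+1)%N)) => /=; lia.
elim=> [|q IHq] le_qp.
  by split=> //; have := pairE 0%N le_qp; rewrite double0; lia.
have [_ sq] := IHq (ltnW le_qp).
have le_sq : s q.*2.+1 + s q.*2.+2 <= N by apply: s_le; lia.
have ge0 : 0 <= s q.*2.+2 by apply: s_ge0; lia.
have := pairE _ le_qp; rewrite doubleS; lia.
Qed.

(** * Chained alternating sign matrices *)

(** The sum of the partial column sums at a given height is a sum of row sums,
    so it vanishes; having a constant sign, all of them vanish. *)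
Lemma zero_of_partial_columns n (M : 'M[int]_n) :
  (forall i, \sum_(j < n) M i j = 0) ->
  (forall i m, partial_sum (fun j => M (rev_ord j) i) m <= 0) -> M = 0.
Proof.
move=> row0 col_le0.
have col0 m i : partial_sum (fun j => M (rev_ord j) i) m = 0.
  apply/eqP; rewrite -oppr_eq0; apply/eqP.
  pose F i := - partial_sum (fun j => M (rev_ord j) i) m.
  apply: (sum_ge0_tight (F := F)) => [{}i|]; first by rewrite oppr_ge0.
  by rewrite sumrN exchange_big /= big1 ?oppr0.
apply/matrixP => j i; rewrite mxE -[j]rev_ordK.
have := partial_sumS (fun j => M (rev_ord j) i) (rev_ord j).
by rewrite !col0 add0r => <-.
Qed.

Section Levels.
Variables n k : nat.
Implicit Type A : k.-tuple 'M[int]_n.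

Lemma level0 A : level A 0 = 0. Proof. by []. Qed.

Lemma level_tnth A (l : 'I_k) : level A l.+1 = tnth A l.
Proof. by rewrite (tnth_nth 0). Qed.

Definition level_sum A l : int := \sum_(i < n) \sum_(j < n) level A l i j.

Lemma total_sumE A : total_sum A = \sum_(l < k) level_sum A l.+1.
Proof. by apply: eq_bigr => l _; rewrite -level_tnth. Qed.

Lemma level_sum0 A : level_sum A 0 = 0.
Proof. by apply: big1 => i _; apply: big1 => j _; rewrite level0 mxE. Qed.

Lemma admissible_row A l : chained_admissible A -> (1 <= l <= k)%N ->
  forall i, partial_sums01 (level A l i).
Proof.
by case=> _ rowA _ l_in i; apply: partial_sums01_bounded => m m_in; apply: rowA.
Qed.

Lemma admissible_row_sum A l : chained_admissible A -> (1 <= l <= k)%N ->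
  forall i, \sum_(j < n) level A l i j \in [:: 0; 1].
Proof.
move=> admA l_in i; rewrite -(partial_sum_all _ (leqnn n)).
exact: admissible_row.
Qed.

Lemma admissible_chain A l m : chained_admissible A -> (l < k)%N ->
  (1 <= m <= n)%N -> forall i,
  \sum_(j < n) level A l i j
    + partial_sum (fun j => level A l.+1 (rev_ord j) i) m \in [:: 0; 1].
Proof. by case=> _ _ chainA lt_lk m_in i; apply: (chainA i m l.+1). Qed.

Lemma sum_rev_ord (F : 'I_n -> int) :
  \sum_(j < n) F (rev_ord j) = \sum_(j < n) F j.
Proof. by rewrite [RHS](reindex_inj rev_ord_inj). Qed.

Lemma admissible_chain_sum A l : chained_admissible A -> (l < k)%N ->
  forall i, \sum_(j < n) level A l i j + \sum_(j < n) level A l.+1 j i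
    \in [:: 0; 1].
Proof.
move=> admA lt_lk i; have n_gt0 : (0 < n)%N by exact: leq_ltn_trans (ltn_ord i).
have := admissible_chain admA lt_lk (m := n) _ i.
rewrite partial_sum_all // (sum_rev_ord (fun j => level A l.+1 j i)).
by apply; rewrite n_gt0 leqnn.
Qed.

Lemma level_sum_ge0 A l : chained_admissible A -> (l <= k)%N ->
  0 <= level_sum A l.
Proof.
move=> admA; case: l => [|l] lt_lk; first by rewrite level_sum0.
apply: sumr_ge0 => i _.
by have /in01P/andP[] := admissible_row_sum admA (l := l.+1) lt_lk i.
Qed.

Lemma level_sum_pair A l : chained_admissible A -> (l < k)%N ->
  level_sum A l + level_sum A l.+1 <= n%:R.
Proof.
move=> admA lt_lk; rewrite {2}/level_sum exchange_big -big_split /=.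
rewrite -[n in n%:R]card_ord -sumr_const; apply: ler_sum => i _.
by have /in01P/andP[] := admissible_chain_sum admA lt_lk i.
Qed.

Lemma admissible_tight A p : k = p.*2.+1 -> chained_admissible A ->
  total_sum A <= n%:R * p.+1%:R /\
  (total_sum A = n%:R * p.+1%:R -> forall q, (q <= p)%N ->
   level_sum A q.*2 = 0 /\ level_sum A q.*2.+1 = n%:R).
Proof.
move=> eq_k admA; rewrite total_sumE.
have := @tight_pairing (level_sum A) n%:R p (level_sum0 A).
rewrite -eq_k; apply=> l lt_lk; first exact: level_sum_ge0.
exact: level_sum_pair.
Qed.

Definition asm_at_odd_levels A p : Prop :=
  forall q, (q <= p)%N -> level A q.*2 = 0 /\ asm n (level A q.*2.+1).

Lemma admissible_sign A l : chained_admissible A -> (1 <= l <= k)%N ->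
  sign_matrix (level A l).
Proof.
case: l => // l [A_sgn _ _] lt_lk.
by rewrite (level_tnth A (Ordinal (lt_lk : (l < k)%N))).
Qed.

Lemma level_even_eq0 A l : chained_admissible A -> (l < k)%N ->
  (forall i, \sum_(j < n) level A l i j = 1) ->
  (forall i, \sum_(j < n) level A l.+1 i j = 0) -> level A l.+1 = 0.
Proof.
move=> admA lt_lk row1 row0; apply: zero_of_partial_columns => // i.
suff col_le0 m : (1 <= m <= n)%N ->
    partial_sum (fun j => level A l.+1 (rev_ord j) i) m <= 0.
  case=> [|m]; first by rewrite partial_sum0.
  case: (leqP m.+1 n) => [le_mn|lt_nm]; first exact: col_le0.
  rewrite (partial_sum_all _ (ltnW lt_nm)) -(partial_sum_all _ (leqnn n)).
  by apply: col_le0; have := ltn_ord i; lia.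
move=> m_in; have := admissible_chain admA lt_lk m_in i.
by rewrite row1 => /in01P/andP[_]; rewrite gerDl.
Qed.

Lemma level_odd_asm A l : chained_admissible A -> (l < k)%N ->
  level A l = 0 -> level_sum A l.+1 = n%:R -> asm n (level A l.+1).
Proof.
move=> admA lt_lk A0 sumA.
have prev0 i : \sum_(j < n) level A l i j = 0.
  by apply: big1 => j _; rewrite A0 mxE.
have row1 : forall i, \sum_(j < n) level A l.+1 i j = 1.
  apply: sum_le1_tight sumA => i.
  by have /in01P/andP[] := admissible_row_sum admA (l := l.+1) lt_lk i.
have col1 : forall i, \sum_(j < n) level A l.+1 j i = 1.
  apply: sum_le1_tight => [i|]; last by rewrite exchange_big.
  have := admissible_chain_sum admA lt_lk i.
  by rewrite prev0 add0r => /in01P/andP[].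
apply/asmP; split=> // [|i|i].
- exact: admissible_sign.
- exact: admissible_row.
have up01 : partial_sums01 (fun j => level A l.+1 (rev_ord j) i).
  apply: partial_sums01_bounded => m m_in.
  by have := admissible_chain admA lt_lk m_in i; rewrite prev0 add0r.
(* Reading the column from the bottom twice is reading it from the top. *)
have := partial_sums01_rev _ up01.
rewrite (sum_rev_ord (fun j => level A l.+1 j i)) => /(_ (col1 i)) down01 m.
rewrite (@eq_partial_sum _ _
  (fun j => level A l.+1 (rev_ord (rev_ord j)) i)) // => j.
by rewrite rev_ordK.
Qed.

Lemma asm_at_odd_levels_of_tight A p : k = p.*2.+1 -> chained_admissible A ->
  total_sum A = n%:R * p.+1%:R -> asm_at_odd_levels A p.
Proof.
move=> eq_k admA sumA.
have [_ /(_ sumA) sums] := admissible_tight eq_k admA.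
elim=> [|q IHq] le_qp.
  split=> //; apply: level_odd_asm => //; first by rewrite eq_k.
  by case: (sums _ le_qp).
have [_ /asmP[_ row1 _ _ _]] := IHq (ltnW le_qp).
have [even0 oddn] := sums _ le_qp.
have A0 : level A q.+1.*2 = 0.
  rewrite doubleS; apply: level_even_eq0 => //; first by rewrite eq_k; lia.
  apply: sum_ge0_tight even0 => i.
  have le_k : (1 <= q.+1.*2 <= k)%N by rewrite eq_k; lia.
  by have /in01P/andP[] := admissible_row_sum admA le_k i.
by split=> //; apply: level_odd_asm => //; rewrite eq_k; lia.
Qed.

Lemma level_dichotomy A p l : k = p.*2.+1 -> asm_at_odd_levels A p ->
  (l <= k)%N ->
  if odd l then asm n (level A l) else level A l = 0.
Proof.
move=> eq_k shapeA le_l; rewrite -[l]odd_double_half.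
have [|even0 odd_asm] := shapeA l./2; first by lia.
by rewrite oddD odd_double; case: (odd l).
Qed.

Lemma asm_at_odd_levels_admissible A p : k = p.*2.+1 ->
  asm_at_odd_levels A p -> chained_admissible A.
Proof.
move=> eq_k shapeA; split.
- move=> l i j; rewrite -level_tnth.
  have := level_dichotomy eq_k shapeA (ltn_ord l).
  case: ifP => _; first by case.
  by move=> ->; rewrite mxE.
- move=> i m l _ /andP[_ /(level_dichotomy eq_k shapeA)].
  case: ifP => _; first by case/asmP => _ _ _ /(_ i m).
  by move=> A0; rewrite big1 // => j _; rewrite A0 mxE.
move=> i m [|l] // _ /andP[_] lt_l.
have := level_dichotomy eq_k shapeA (ltnW lt_l).
have := level_dichotomy eq_k shapeA lt_l; rewrite /=.
case: (odd l) => /=.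
  move=> A0 /asmP[_ -> _ _ _]; rewrite [X in _ + X]big1 // => j _.
  by rewrite A0 mxE.
case/asmP => _ _ /(_ i) col1 _ /(_ i) col01 A0.
rewrite big1 ?add0r; last by move=> j _; rewrite A0 mxE.
exact: (partial_sums01_rev col1 col01).
Qed.

Lemma asm_at_odd_levels_total A p : k = p.*2.+1 ->
  asm_at_odd_levels A p -> total_sum A = n%:R * p.+1%:R.
Proof.
move=> eq_k shapeA; rewrite total_sumE.
have -> : \sum_(l < k) level_sum A l.+1
    = \sum_(l < p.*2.+1) level_sum A l.+1 by rewrite -eq_k.
rewrite sum_pairs ?level_sum0 //.
transitivity (\sum_(q < p.+1) n%:R : int).
  apply: eq_bigr => q _; have [A0 /asmP[_ row1 _ _ _]] := shapeA q (ltn_ord q).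
  rewrite {1}/level_sum A0 big1 ?add0r; last first.
    by move=> i _; apply: big1 => j _; rewrite mxE.
  by rewrite /level_sum (eq_bigr (fun=> 1)) // sumr_const card_ord.
by rewrite sumr_const card_ord mulr_natr.
Qed.

Definition interleave_zeros (B : nat -> 'M[int]_n) : k.-tuple 'M[int]_n :=
  [tuple if odd l then 0 else B l./2 | l < k].

Lemma level_interleave_zeros B l : (l < k)%N ->
  level (interleave_zeros B) l.+1 = if odd l then 0 else B l./2.
Proof.
by move=> lt_lk; rewrite (level_tnth _ (Ordinal lt_lk)) tnth_mktuple.
Qed.

Lemma interleave_zeros_shape B p : k = p.*2.+1 ->
  (forall q, (q <= p)%N -> asm n (B q)) ->
  asm_at_odd_levels (interleave_zeros B) p.
Proof.
move=> eq_k asmB q le_qp; split; last first.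
  rewrite level_interleave_zeros ?eq_k; last by lia.
  by rewrite odd_double doubleK; apply: asmB.
case: q le_qp => [|q] le_qp //.
by rewrite doubleS level_interleave_zeros ?eq_k /= ?odd_double //; lia.
Qed.

(** Identity matrices separated by zeros show that the bound on the total is
    attained, so that the maximal tuples are the tight ones. *)
Lemma chained_linear_asmP A p : k = p.*2.+1 ->
  chained_linear_asm n k A <-> asm_at_odd_levels A p.
Proof.
move=> eq_k; split=> [[admA maxA]|shapeA].
  apply: asm_at_odd_levels_of_tight => //.
  have shape1 := interleave_zeros_shape eq_k (fun q _ => asm1 n).
  apply/eqP; rewrite eq_le (admissible_tight eq_k admA).1 /=.
  rewrite -(asm_at_odd_levels_total eq_k shape1).
  by apply: maxA; apply: asm_at_odd_levels_admissible shape1.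
split; first exact: asm_at_odd_levels_admissible shapeA.
move=> A' admA'; rewrite (asm_at_odd_levels_total eq_k shapeA).
exact: (admissible_tight eq_k admA').1.
Qed.

End Levels.

Theorem theorem4p9 (n k : nat) (hn : (1 <= n)%N) (hk : (1 <= k)%N)
    (hodd : odd k) :
  exists f : k.-tuple 'M[int]_n -> ((k + 1) %/ 2)%N.-tuple 'M[int]_n,
    set_bij (chained_linear_asm n k) (asm_tuples n ((k + 1) %/ 2)%N) f.
Proof.
set h := ((k + 1) %/ 2)%N.
have [p [eq_k eq_h]] : exists p, k = p.*2.+1 /\ h = p.+1.
  by exists k./2; rewrite /h; split; lia.
exists (fun A => [tuple level A l.*2.+1 | l < h]); split=> [A|A A'|B].
- move=> /(chained_linear_asmP A eq_k) shapeA l; rewrite tnth_mktuple.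
  by apply: (shapeA l _).2; rewrite -ltnS -eq_h.
- rewrite !inE => /(chained_linear_asmP A eq_k) shapeA.
  move=> /(chained_linear_asmP A' eq_k) shapeA' eqAA'.
  have eq_odd q : (q <= p)%N -> level A q.*2.+1 = level A' q.*2.+1.
    move=> le_qp; have lt_qh : (q < h)%N by rewrite eq_h.
    move/(congr1 (fun B => tnth B (Ordinal lt_qh))): eqAA'.
    by rewrite !tnth_mktuple.
  apply: eq_from_tnth => l; rewrite -!level_tnth.
  have := level_dichotomy eq_k shapeA (ltn_ord l).
  have := level_dichotomy eq_k shapeA' (ltn_ord l).
  rewrite /=; case: ifP => [odd_l _ _|_ -> -> //].
  have -> : l = l./2.*2 :> nat by move: odd_l; rewrite /=; lia.
  by apply: eq_odd; have := ltn_ord l; lia.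
move=> asmB; pose B' q := nth 0 B q.
exists (interleave_zeros k B').
  apply/(chained_linear_asmP _ eq_k).
  apply: interleave_zeros_shape => // q le_qp.
  have lt_qh : (q < h)%N by rewrite eq_h.
  by have := asmB (Ordinal lt_qh); rewrite (tnth_nth 0).
apply: eq_from_tnth => l; rewrite tnth_mktuple level_interleave_zeros.
  by rewrite odd_double doubleK (tnth_nth 0).
by have := ltn_ord l; lia.
Qed.
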